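(* (i) If $d \geq 1$ is an odd integer that is not a perfect square, then $2^k d \in \mathcal{P}(-1,1)$ for all but finitely many integers $k \geq 1$. (ii) Conversely, if $2^k d \in \mathcal{P}(-1,1)$ for some integers $k \geq 0$ and $d \geq 1$, then $d$ is not a perfect square.
   Context: Let $\mathcal{S} \subset \mathbb{Z}$. An integer $n > 1$ with positive divisors $1 = d_0 < d_1 < \cdots < d_r < d_{r+1} = n$ is called $\mathcal{S}$-perfect (of the first kind) if there exist $\lambda_1, \ldots, \lambda_r \in \mathcal{S}$ (not necessarily distinct) such that $1+\sum_{j=1}^{r}\lambda_j d_j = n$. (The divisor $1$ always has coefficient $1$, and every divisor $d$ with $1<d<n$ must receive a coefficient from $\mathcal{S}$.) $\mathcal{P}(-1,1)$ denotes the set of all $\{-1,1\}$-perfect numbers. *)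

(* Defs.v *)
From mathcomp Require Import all_boot all_order all_algebra.

Set Implicit Arguments.
Unset Strict Implicit.
Unset Printing Implicit Defensive.

Import GRing.Theory.
Local Open Scope ring_scope.

(* The coefficient [lam d] is attached to the divisor [d] itself rather than to
   its rank among the divisors; values of [lam] outside the divisors
   1 < d < n are irrelevant. *)
Definition S_perfect (S : int -> Prop) (n : nat) : Prop :=
  (1 < n)%N /\
  exists lam : nat -> int,
    (forall d : nat, (d %| n)%N -> (1 < d < n)%N -> S (lam d)) /\
    1 + \sum_(d <- divisors n | (1 < d < n)%N) lam d * d%:Z = n%:Z.

Definition pm1_perfect : nat -> Prop :=
  S_perfect (fun x : int => x = -1 \/ x = 1).

Definition perfect_square (d : nat) : Prop := exists m : nat, d = (m ^ 2)%N.

(* Main.v *)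
Require Import Defs.
From mathcomp Require Import all_boot all_order all_algebra.
From mathcomp Require Import zify ring.

Set Implicit Arguments.
Unset Strict Implicit.
Unset Printing Implicit Defensive.

Import GRing.Theory Num.Theory.
Local Open Scope ring_scope.

(** For (ii), the signs do not matter modulo 2, so a {-1,1}-perfect number has an
    even sum of divisors; but the sum of divisors of [2 ^ k * m ^ 2] is odd.

    For (i), group the divisors [2 ^ i * e] of [n = 2 ^ k * d] by their odd part
    [e]. The signed sums of [1, 2, ..., 2 ^ k] are exactly the odd numbers of
    absolute value below [2 ^ k.+1], so one has to solve
    [\sum_(e %| d) c_e * e = 0] in such odd [c_e], where [c_1 = 3 %[mod 4]] (the
    divisor [1] has sign [+]) and [c_d < 0] (moving [n] to the left gives it the
    sign [-]). Let [S] be the sum of the divisors of [d] other than [1] and [d],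
    which is even as [d] is not a square; then [c_e = 1] for [e <> 1, d],
    [c_d = - m] and [c_1 = m * d - S] work for [m = 1] or [m = 3], independently
    of [k]. *)

Lemma perm_divisors_codivisor (d : nat) : (0 < d)%N ->
  perm_eq [seq (d %/ e)%N | e <- divisors d] (divisors d).
Proof.
move=> d_gt0; have inv e : (e %| d)%N -> (d %/ (d %/ e))%N = e.
  by move=> ed; rewrite divnA // mulKn.
apply: uniq_perm; last move=> x.
- rewrite map_inj_in_uniq ?divisors_uniq // => x y.
  by rewrite -!dvdn_divisors // => xd yd eq; rewrite -(inv _ xd) eq inv.
- exact: divisors_uniq.
apply/mapP/idP => [[e]|]; rewrite -!dvdn_divisors // => ed.
  by move=> ->; apply: dvdn_div.
by exists (d %/ x)%N; rewrite ?inv // -dvdn_divisors // dvdn_div.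
Qed.

(** The involution sending [e] to [d %/ e] matches the divisors below the square root of [d] with
    those above it, so only a divisor equal to the root can make the count odd. *)
Lemma odd_size_divisors (d : nat) : (0 < d)%N ->
  odd (size (divisors d)) = has (fun e => (e ^ 2 == d)%N) (divisors d).
Proof.
move=> d_gt0; set s := divisors d.
have sz : (size s = count (fun e => e ^ 2 < d)%N s +
    (count (fun e => d < e ^ 2)%N s + count (fun e => e ^ 2 == d)%N s))%N.
  by elim: (s) => //= e l ->; case: ltngtP => _ /=; lia.
have sym : count (fun e => e ^ 2 < d)%N s = count (fun e => d < e ^ 2)%N s.
  rewrite -(permP (perm_divisors_codivisor d_gt0)) count_map.
  apply: eq_in_count => e; rewrite -dvdn_divisors // => /= ed.
  move/divnK: ed; set q := (d %/ e)%N => qe.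
  have [q0 e0] : (0 < q /\ 0 < e)%N by apply/andP; rewrite -muln_gt0 qe.
  by rewrite -qe !expnS !expn0 !muln1 ltn_pmul2l // ltn_pmul2r.
rewrite sz sym addnA addnn oddD odd_double /=; case: hasP => [[e es /eqP ed]|nsq].
  have /eq_count -> : (fun x => x ^ 2 == d)%N =1 pred1 e.
    by move=> x /=; rewrite -ed eqn_exp2r.
  by rewrite count_uniq_mem ?divisors_uniq ?es.
rewrite (eq_in_count (a2 := pred0)) ?count_pred0 // => x xs.
by apply/negP => xd; apply: nsq; exists x.
Qed.

Lemma odd_sum_count (s : seq nat) : odd (\sum_(x <- s) x) = odd (count odd s).
Proof. by elim: s => [|x s IH]; rewrite ?big_nil ?big_cons //= !oddD IH oddb. Qed.

(** Only odd divisors affect the parity of the sum, and those of [2 ^ k * d] are exactly the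
    divisors of [d]. *)
Lemma odd_sum_divisors (k d : nat) : odd d ->
  odd (\sum_(x <- divisors (2 ^ k * d)) x) = odd (size (divisors d)).
Proof.
move=> d_odd; have d_gt0 := odd_gt0 d_odd.
have n_gt0 : (0 < 2 ^ k * d)%N by rewrite muln_gt0 expn_gt0.
rewrite odd_sum_count -size_filter; congr odd; apply: perm_size.
apply: uniq_perm; rewrite ?filter_uniq ?divisors_uniq // => x.
rewrite mem_filter -!dvdn_divisors //; apply/andP/idP => [[x_odd]|xd].
  by rewrite Gauss_dvdr // coprimeXr // coprimen2.
by split; [apply: dvdn_odd xd d_odd | apply: dvdn_mull].
Qed.

Lemma logn2_pow2M (i e : nat) : odd e -> logn 2 (2 ^ i * e)%N = i.
Proof.
move=> e_odd; rewrite lognM ?expn_gt0 ?(odd_gt0 e_odd) // pfactorK //.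
by rewrite logn_coprime ?coprime2n // addn0.
Qed.

Lemma perm_divisors_pow2M (k d : nat) : odd d ->
  perm_eq (divisors (2 ^ k * d))
    [seq (2 ^ i * e)%N | e <- divisors d, i <- iota 0 k.+1].
Proof.
move=> d_odd; have d_gt0 := odd_gt0 d_odd.
have n_gt0 : (0 < 2 ^ k * d)%N by rewrite muln_gt0 expn_gt0.
apply: uniq_perm; rewrite ?divisors_uniq //.
  apply: allpairs_uniq; rewrite ?divisors_uniq ?iota_uniq //.
  move=> u v /allpairsP[[a b] [ad _ ->]] /allpairsP[[a' b'] [a'd _ ->]] /= eq.
  move: ad a'd; rewrite -!dvdn_divisors // => ad a'd.
  have {}ad := dvdn_odd ad d_odd; have {}a'd := dvdn_odd a'd d_odd.
  have ebb : b = b' by rewrite -(logn2_pow2M b ad) eq logn2_pow2M.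
  by move: eq; rewrite ebb => /eqP; rewrite eqn_pmul2l ?expn_gt0 // => /eqP->.
move=> x; rewrite -dvdn_divisors //; apply/idP/allpairsP => [xn|].
  have x_gt0 := dvdn_gt0 n_gt0 xn.
  exists (x`_(2^')%N, logn 2 x)%N; split.
  - rewrite /= -dvdn_divisors //; have := dvdn_trans (dvdn_part 2^'%N x) xn.
    by rewrite Gauss_dvdr // coprimeXr // coprimen2 odd_2'nat part_pnat.
  - rewrite mem_iota add0n ltnS /=.
    by have := dvdn_leq_log 2 n_gt0 xn; rewrite logn2_pow2M.
  - by rewrite /= -p_part partnC.
move=> [[e i] [ed]]; rewrite mem_iota add0n ltnS /= => ik ->.
by move: ed; rewrite -dvdn_divisors // => /= ed; rewrite dvdn_mul ?dvdn_exp2l.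
Qed.

Lemma sum_divisors_inner (n : nat) (F : nat -> int) : (1 < n)%N ->
  \sum_(x <- divisors n) F x =
    F 1%N + (F n + \sum_(x <- divisors n | (1 < x < n)%N) F x).
Proof.
move=> n_gt1; have n_gt0 := ltnW n_gt1.
rewrite (bigD1_seq 1%N) ?divisors_uniq ?divisor1 //=; congr (_ + _).
rewrite -big_filter (bigD1_seq n) ?filter_uniq ?divisors_uniq //=; last first.
  by rewrite mem_filter divisors_id // gtn_eqF.
rewrite big_filter_cond big_seq_cond [in RHS]big_seq_cond; congr (_ + _).
apply: eq_bigl => x; apply: andb_id2l; rewrite -dvdn_divisors // => xn.
by have := dvdn_leq n_gt0 xn; have := dvdn_gt0 n_gt0 xn; lia.
Qed.

Lemma Posz_sum (I : Type) (r : seq I) (P : pred I) (F : I -> nat) :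
  (\sum_(i <- r | P i) F i)%N%:Z = \sum_(i <- r | P i) (F i)%:Z.
Proof. exact: (big_morph Posz PoszD). Qed.

Lemma pm1_perfect_sum0 (n : nat) (lam : nat -> int) : (1 < n)%N ->
  (forall x, lam x = -1 \/ lam x = 1) -> lam 1%N = 1 -> lam n = -1 ->
  \sum_(x <- divisors n) lam x * x%:Z = 0 -> pm1_perfect n.
Proof.
move=> n_gt1 lampm lam1 lamn.
rewrite sum_divisors_inner // lam1 lamn => sum0; split=> //.
by exists lam; split=> //; move: sum0; set T := (\sum_(x <- _ | _) _); lia.
Qed.

Lemma pm1_perfect_even_sum (n : nat) : pm1_perfect n ->
  ~~ odd (\sum_(x <- divisors n) x).
Proof.
move=> [n_gt1 [lam [lampm sumE]]]; have n_gt0 := ltnW n_gt1.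
have := sum_divisors_inner Posz n_gt1; rewrite -!Posz_sum.
(* Each sign is [1] minus twice the indicator of [-1], so the signed and plain sums differ by an
   even number. *)
have : \sum_(x <- divisors n | (1 < x < n)%N) lam x * x%:Z =
    \sum_(x <- divisors n | (1 < x < n)%N) x%:Z -
    2 * \sum_(x <- divisors n | (1 < x < n)%N) (lam x != 1)%:Z * x%:Z.
  rewrite mulr_sumr -sumrB big_seq_cond [RHS]big_seq_cond.
  apply: eq_bigr => x /andP[]; rewrite -dvdn_divisors // => xn /(lampm x xn).
  by case=> -> /=; ring.
rewrite -!Posz_sum; lia.
Qed.

Lemma pm1_perfect_pow2M (k d : nat) (f : nat -> nat -> int) :
  odd d -> (1 < 2 ^ k * d)%N -> (forall i e, f i e = -1 \/ f i e = 1) ->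
  f 0%N 1%N = 1 -> f k d = -1 ->
  \sum_(e <- divisors d) (\sum_(i < k.+1) f i e * 2 ^+ i) * e%:Z = 0 ->
  pm1_perfect (2 ^ k * d).
Proof.
move=> d_odd n_gt1 fpm f01 fkd sum0; have d_gt0 := odd_gt0 d_odd.
(* Splitting [x] into its exponent of 2 and its odd part makes [f i e] the coefficient of
   [2 ^ i * e]. *)
pose lam x := f (logn 2 x) (x %/ 2 ^ logn 2 x)%N.
have lamE i e : odd e -> lam (2 ^ i * e)%N = f i e.
  by move=> e_odd; rewrite /lam logn2_pow2M // mulKn ?expn_gt0.
apply: (@pm1_perfect_sum0 _ lam) => //.
- by move=> x; apply: fpm.
- by rewrite lamE.
rewrite (perm_big _ (perm_divisors_pow2M k d_odd)) big_allpairs_dep -[RHS]sum0.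
apply: eq_big_seq => e; rewrite -dvdn_divisors // => ed.
rewrite -[iota 0 k.+1]/(index_iota 0 k.+1) big_mkord mulr_suml.
apply: eq_bigr => i _; rewrite lamE; last exact: dvdn_odd ed d_odd.
by rewrite PoszM -mulrA -natz natrX.
Qed.

(** By induction on [k]: giving the top term the sign of [a] ([1] if [a = 0]) leaves a target in the
    range of half the size. *)
Lemma signed_binary (k : nat) (a : int) : - 2 ^+ k <= a < 2 ^+ k ->
  exists b : nat -> int, (forall i, b i = -1 \/ b i = 1) /\
    \sum_(i < k.+1) b i * 2 ^+ i = 2 * a + 1.
Proof.
elim: k a => [|k IH] a; rewrite ?expr0 ?exprS => ha.
  exists (fun=> 2 * a + 1); rewrite big_ord_recl big_ord0 expr0; split; last by ring.
  by move=> _; lia.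
have step (s : int) : s = -1 \/ s = 1 -> - 2 ^+ k <= a - s * 2 ^+ k < 2 ^+ k ->
    exists b : nat -> int, (forall i, b i = -1 \/ b i = 1) /\
      \sum_(i < k.+2) b i * 2 ^+ i = 2 * a + 1.
  move=> spm /IH[b [bpm sb]].
  exists (fun i => if i == k.+1 then s else b i); split=> [i|].
    by case: eqP.
  rewrite big_ord_recr /= eqxx.
  under eq_bigr => i _ do rewrite (ltn_eqF (ltn_ord i)).
  by rewrite sb exprS; ring.
have [a_ge0|a_lt0] := lerP 0 a; [apply: (step 1)|apply: (step (-1))]; lia.
Qed.

Lemma pm1_perfect_pow2M_nonsquare (d : nat) : odd d -> ~ perfect_square d ->
  exists K, forall k, (K < k)%N -> pm1_perfect (2 ^ k * d).
Proof.
move=> d_odd d_nsq; have d_gt0 := odd_gt0 d_odd.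
have d_neq1 : d != 1%N by apply/eqP => d1; apply: d_nsq; exists 1%N.
have d_gt1 : (1 < d)%N by lia.
pose S := (\sum_(e <- divisors d | 1 < e < d) e)%N.
have S_even : ~~ odd S.
  have := odd_sum_divisors 0 d_odd; rewrite mul1n odd_size_divisors //.
  have -> : has (fun e => e ^ 2 == d)%N (divisors d) = false.
    by apply/hasP => -[e _ /eqP ed]; apply: d_nsq; exists e.
  have := sum_divisors_inner Posz d_gt1; rewrite -!Posz_sum -/S; lia.
(* The two choices of [m = 2 * s - 1] give values of [m * d - S] differing by
   [2 * d = 2 %[mod 4]]. *)
have [s [a [s12 sa]]] : exists s : nat, exists a : int, (0 < s <= 2)%N /\
    d%:Z * (2 * s%:Z - 1) - S%:Z = 4 * a + 3.
  have [c|c] : (exists a : int, d%:Z - S%:Z = 4 * a + 3) \/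
      (exists a : int, d%:Z * 3 - S%:Z = 4 * a + 3).
    (* As [d] is odd and [S] even, [d - S = 2 * (d./2 - S./2) + 1], which is 3 modulo 4 exactly when
       [d./2 + S./2] is odd. *)
    case ow: (odd (d./2 + S./2)); [left; exists ((d./2 + S./2)./2%:Z - S./2%:Z)|
      right; exists ((d./2 + S./2)./2%:Z - S./2%:Z + d./2%:Z)]; lia.
  - by case: c => a ha; exists 1%N, a; split=> //; rewrite -ha; ring.
  - by case: c => a ha; exists 2, a; split=> //; rewrite -ha; ring.
(* Since [m <= 3], the bound [3 * d + S] dominates the absolute value of [m * d - S = 4 * a + 3].
   The exponent is now [k.+1]: one sign of each extreme row is prescribed, and [k.+1] signs remain
   free. *)
exists (3 * d + S).+1 => -[|k] // Kk.
have big : ((3 * d + S)%N%:Z < 2 ^+ k).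
  rewrite -natz -natrX ltr_nat; apply: leq_trans (ltnW (ltn_expl _ _)) => //.
(* Row [1]: the sign of [2 ^ 0] is [1], and the shifted signs [b1] give
   [1 + 2 * (2 * a + 1) = 4 * a + 3]. *)
have [|b1 [b1pm sb1]] := @signed_binary k a; first by nia.
(* Row [d]: the top sign is [-1], so the lower terms must add up to [2 ^+ k.+1 - m], where
   [m = 2 * s - 1]. *)
have [|bd [bdpm sbd]] := @signed_binary k (2 ^+ k - s%:Z); first by lia.
(* In the other rows the top power minus all lower ones leaves 1. *)
pose f i e : int := if e == 1%N then (if i is j.+1 then b1 j else 1) else
  if e == d then (if i == k.+1 then -1 else bd i) else
  if i == k.+1 then 1 else -1.
apply: (@pm1_perfect_pow2M _ _ f) => //.
- by rewrite expnS; have := expn_gt0 2 k; nia.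
- by move=> i e; rewrite /f; case: eqP => _; [case: i; auto|]; do 2?case: eqP; auto.
- by rewrite /f (negPf d_neq1) !eqxx.
rewrite sum_divisors_inner //.
have -> : \sum_(i < k.+2) f i 1%N * 2 ^+ i = 4 * a + 3.
  rewrite big_ord_recl /f /=.
  under eq_bigr => i _ do rewrite exprS mulrCA.
  by rewrite -mulr_sumr sb1; ring.
have -> : \sum_(i < k.+2) f i d * 2 ^+ i = 1 - 2 * s%:Z.
  rewrite big_ord_recr /f /= (negPf d_neq1) !eqxx.
  under eq_bigr => i _ do rewrite (ltn_eqF (ltn_ord i)).
  by rewrite sbd exprS; ring.
rewrite (eq_bigr (fun e => e%:Z)) => [|e]; last first.
  move=> /andP[/gtn_eqF e1 /ltn_eqF ed].
  rewrite big_ord_recr /f /= e1 ed eqxx.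
  under eq_bigr => i _ do rewrite (ltn_eqF (ltn_ord i)).
  by rewrite -mulr_sumr -[2 ^+ k.+1](subrK 1) subrX1; ring.
by rewrite -Posz_sum -/S -sa; ring.
Qed.

Lemma odd_sum_divisors_pow2M_square (k m : nat) : (0 < m)%N ->
  odd (\sum_(x <- divisors (2 ^ k * m ^ 2)) x).
Proof.
move=> m_gt0; pose u := (m`_(2^'))%N; pose j := logn 2 m.
have u_odd : odd u by rewrite odd_2'nat part_pnat.
(* Moving the powers of 2 of [m] into the first factor leaves the odd square [u ^ 2], whose number
   of divisors is odd. *)
have -> : (2 ^ k * m ^ 2 = 2 ^ (k + 2 * j) * u ^ 2)%N.
  rewrite -{1}(partnC 2%N m_gt0) p_part -/u -/j expnMn expnD mulnA.
  by rewrite -expnM (mulnC j).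
rewrite odd_sum_divisors ?oddX // odd_size_divisors ?expn_gt0 ?odd_gt0 //.
by apply/hasP; exists u; rewrite // -dvdn_divisors ?dvdn_exp // expn_gt0 odd_gt0.
Qed.

Theorem theorem15 :
  (forall d : nat, (1 <= d)%N -> odd d -> ~ perfect_square d ->
     exists E : seq nat, forall k : nat, (1 <= k)%N -> k \notin E ->
       pm1_perfect (2 ^ k * d)%N)
  /\
  (forall k d : nat, (1 <= d)%N -> pm1_perfect (2 ^ k * d)%N ->
     ~ perfect_square d).
Proof.
split=> [d _ d_odd d_nsq|k d d_gt0 /pm1_perfect_even_sum + [m dm]].
  have [K HK] := pm1_perfect_pow2M_nonsquare d_odd d_nsq.
  exists (iota 0 K.+1) => k _; rewrite mem_iota add0n ltnS -ltnNge.
  exact: HK.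
rewrite dm odd_sum_divisors_pow2M_square //.
by move: d_gt0; rewrite dm expn_gt0 orbF.
Qed.
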